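(* Let $n>3$ be a square-free integer. Then the number of orbits in $M_{-n}$ under the action of $G=\mathrm{PSL}(2,\mathbb{Z})$ is $$|\mathcal{O}^G(M_{-n})| = d(n)+\frac{2}{3}\sum_{i=1}^{\lfloor n/2\rfloor}\left[d(i^2+n)-2\,d_{\leq i}(i^2+n)\right].$$
   Context: For a square-free positive integer $n$, $M_{-n}=\{\frac{a+\sqrt{-n}}{c}\in\mathbb{Q}(\sqrt{-n}) : a,\ b=\frac{a^2+n}{c},\ c\in\mathbb{Z}\}$ (so $c\neq 0$ may be positive or negative, and $c\mid a^2+n$). $G=\mathrm{PSL}(2,\mathbb{Z})$ acts on $M_{-n}$ by Möbius transformations $z\mapsto (pz+q)/(rz+s)$, $p,q,r,s\in\mathbb{Z}$, $ps-qr=1$; $\mathcal{O}^G(M_{-n})$ is the set of orbits. $d(m)$ is the number of positive divisors of $m$, and for positive integers $k\leq m$, $d_{\leq k}(m)$ is the number of positive divisors of $m$ that are less than or equal to $k$. *)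

(* Defs.v *)
From HB Require Import structures.
From mathcomp Require Import all_boot all_order all_algebra all_field.
From mathcomp Require Import boolp classical_sets functions cardinality.
From mathcomp Require Import finmap ring.

Set Implicit Arguments.
Unset Strict Implicit.
Unset Printing Implicit Defensive.

Import Order.TTheory GRing.Theory Num.Theory.
Local Open Scope quotient_scope.
Local Open Scope ring_scope.

Definition squarefree (n : nat) : Prop := forall k : nat, (k ^ 2 %| n)%N -> k = 1%N.

Definition ndiv (m : nat) : nat := size (divisors m).

Definition ndiv_le (k m : nat) : nat := count (fun e => (e <= k)%N) (divisors m).

Definition SL2Z : Type := {A : 'M[int]_2 | \det A == 1}.
HB.instance Definition _ := Choice.on SL2Z.

Section SL2ZGroup.
Implicit Types A B : SL2Z.

Lemma det_SL2Z A : \det (val A) = 1. Proof. exact: (eqP (valP A)). Qed.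

Lemma det_SL2ZE A :
  val A 0 0 * val A 1 1 - val A 0 1 * val A 1 0 = 1.
Proof.
have := det_SL2Z A; rewrite (expand_det_row _ 0) !big_ord_recl big_ord0 /cofactor.
have l0 (i : 'I_1) : lift (0 : 'I_2) i = 1 by apply: val_inj; case: i => [[]].
have l1 (i : 'I_1) : lift (1 : 'I_2) i = 0 by apply: val_inj; case: i => [[]].
by rewrite !det_mx11 !mxE !l0 !l1 /= !expr0 !expr1 mul1r mulN1r mulrN addr0.
Qed.

Fact SL2Z_one_subproof : \det (1%:M : 'M[int]_2) == 1.
Proof. by rewrite det1. Qed.

Fact SL2Z_mul_subproof A B : \det (val A *m val B) == 1.
Proof. by rewrite det_mulmx !det_SL2Z mulr1. Qed.

Fact SL2Z_inv_subproof A : \det (invmx (val A)) == 1.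
Proof. by rewrite det_inv det_SL2Z invr1. Qed.

Fact SL2Z_opp_subproof A : \det (- val A) == 1.
Proof. by rewrite -scaleN1r detZ det_SL2Z mulr1 expr2 mulrNN mulr1. Qed.

Definition SL2Z_one : SL2Z := Sub 1%:M SL2Z_one_subproof.
Definition SL2Z_mul A B : SL2Z := Sub (val A *m val B) (SL2Z_mul_subproof A B).
Definition SL2Z_inv A : SL2Z := Sub (invmx (val A)) (SL2Z_inv_subproof A).
Definition SL2Z_opp A : SL2Z := Sub (- val A) (SL2Z_opp_subproof A).

Lemma SL2Z_unitmx A : val A \in unitmx.
Proof. by rewrite unitmxE det_SL2Z unitr1. Qed.

Fact SL2Z_mulA : associative SL2Z_mul.
Proof. by move=> A B C; apply: val_inj; rewrite /= mulmxA. Qed.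
Fact SL2Z_mul1 : left_id SL2Z_one SL2Z_mul.
Proof. by move=> A; apply: val_inj; rewrite /= mul1mx. Qed.
Fact SL2Z_mulr1 : right_id SL2Z_one SL2Z_mul.
Proof. by move=> A; apply: val_inj; rewrite /= mulmx1. Qed.
Fact SL2Z_mulV : left_inverse SL2Z_one SL2Z_inv SL2Z_mul.
Proof. by move=> A; apply: val_inj; rewrite /= mulVmx ?SL2Z_unitmx. Qed.
Fact SL2Z_mulrV : right_inverse SL2Z_one SL2Z_inv SL2Z_mul.
Proof. by move=> A; apply: val_inj; rewrite /= mulmxV ?SL2Z_unitmx. Qed.

End SL2ZGroup.

HB.instance Definition _ := isGroup.Build SL2Z
  SL2Z_mulA SL2Z_mul1 SL2Z_mulr1 SL2Z_mulV SL2Z_mulrV.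

Definition eq_sign (A B : SL2Z) : bool := (A == B) || (A == SL2Z_opp B).

Lemma SL2Z_oppK : involutive SL2Z_opp.
Proof. by move=> A; apply: val_inj; rewrite /= opprK. Qed.

Fact eq_sign_refl : reflexive eq_sign.
Proof. by move=> A; rewrite /eq_sign eqxx. Qed.
Fact eq_sign_sym : symmetric eq_sign.
Proof.
by move=> A B; rewrite /eq_sign eq_sym -(inv_eq SL2Z_oppK) [X in _ || X]eq_sym.
Qed.
Fact eq_sign_trans : transitive eq_sign.
Proof.
move=> B A C /orP[/eqP-> //|/eqP->] /orP[] /eqP ->; rewrite /eq_sign ?SL2Z_oppK eqxx //.
by rewrite orbT.
Qed.

Canonical eq_sign_equiv :=
  EquivRel eq_sign eq_sign_refl eq_sign_sym eq_sign_trans.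

Definition PSL2Z : Type := {eq_quot eq_sign}.
HB.instance Definition _ := EqQuotient.on PSL2Z.
HB.instance Definition _ := Choice.on PSL2Z.

Section PSL2ZGroup.
Implicit Types (A B : SL2Z) (g h : PSL2Z).

Lemma PSL2Z_eqP A B : reflect (A = B \/ A = SL2Z_opp B) (\pi_PSL2Z A == \pi_PSL2Z B).
Proof. by rewrite eqmodE /= /eq_sign; apply: (iffP orP) => -[] /eqP; auto. Qed.

Definition PSL2Z_one : PSL2Z := \pi_PSL2Z 1%g.
Definition PSL2Z_mul g h : PSL2Z := \pi_PSL2Z (repr g * repr h)%g.
Definition PSL2Z_inv g : PSL2Z := \pi_PSL2Z (repr g)^-1%g.

Lemma PSL2Z_reprP A : repr (\pi_PSL2Z A) = A \/ repr (\pi_PSL2Z A) = SL2Z_opp A.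
Proof. by apply/PSL2Z_eqP; rewrite reprK. Qed.

Lemma PSL2Z_mul_pi A B : PSL2Z_mul (\pi_PSL2Z A) (\pi_PSL2Z B) = \pi_PSL2Z (A * B)%g.
Proof.
apply/eqP/PSL2Z_eqP.
have [->|->] := PSL2Z_reprP A; have [->|->] := PSL2Z_reprP B; [left|right|right|left];
  by apply: val_inj; rewrite /= ?mulNmx ?mulmxN ?opprK.
Qed.

Lemma PSL2Z_inv_pi A : PSL2Z_inv (\pi_PSL2Z A) = \pi_PSL2Z A^-1%g.
Proof.
apply/eqP/PSL2Z_eqP; have [->|->] := PSL2Z_reprP A; [by left|right].
apply: val_inj => /=; rewrite -scaleN1r invmxZ ?invrN1 ?scaleN1r //.
by rewrite unitmxE (eqP (SL2Z_opp_subproof A)).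
Qed.

Fact PSL2Z_mulA : associative PSL2Z_mul.
Proof.
move=> f g h; elim/quotW: f => A; elim/quotW: g => B; elim/quotW: h => C.
by rewrite (PSL2Z_mul_pi A B) (PSL2Z_mul_pi B C) !PSL2Z_mul_pi mulgA.
Qed.
Fact PSL2Z_mul1 : left_id PSL2Z_one PSL2Z_mul.
Proof. by move=> g; elim/quotW: g => A; rewrite PSL2Z_mul_pi mul1g. Qed.
Fact PSL2Z_mulr1 : right_id PSL2Z_one PSL2Z_mul.
Proof. by move=> g; elim/quotW: g => A; rewrite PSL2Z_mul_pi mulg1. Qed.
Fact PSL2Z_mulV : left_inverse PSL2Z_one PSL2Z_inv PSL2Z_mul.
Proof. by move=> g; elim/quotW: g => A; rewrite PSL2Z_inv_pi PSL2Z_mul_pi mulVg. Qed.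
Fact PSL2Z_mulrV : right_inverse PSL2Z_one PSL2Z_inv PSL2Z_mul.
Proof. by move=> g; elim/quotW: g => A; rewrite PSL2Z_inv_pi PSL2Z_mul_pi mulgV. Qed.

End PSL2ZGroup.

HB.instance Definition _ := isGroup.Build PSL2Z
  PSL2Z_mulA PSL2Z_mul1 PSL2Z_mulr1 PSL2Z_mulV PSL2Z_mulrV.

Definition moebius (A : 'M[int]_2) (z : algC) : algC :=
  ((A 0 0)%:~R * z + (A 0 1)%:~R) / ((A 1 0)%:~R * z + (A 1 1)%:~R).

Definition psl_act (g : PSL2Z) (z : algC) : algC := moebius (val (repr g)) z.

Lemma psl_act_pi (A : SL2Z) z : psl_act (\pi_PSL2Z A) z = moebius (val A) z.
Proof.
rewrite /psl_act; have [->//|->] := PSL2Z_reprP A.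
by rewrite /moebius /= !mxE !rmorphN /= !mulNr -!opprD invrN mulrNN.
Qed.

(* The field Q(sqrt(-n)) is taken inside algC, with sqrt(-n) the root whose
   imaginary part is nonnegative.  The other root defines the same set, since
   (a - s) / c = (- a + s) / (- c).  The divisibility says that
   b = (a ^+ 2 + n) / c is an integer. *)
Definition M (n : nat) : set algC :=
  [set z | exists a c : int, [/\ c != 0, (c %| a ^+ 2 + n%:Z)%Z
     & z = (a%:~R + sqrtC (- n%:R)) / c%:~R]]%classic.

Definition orbit (z : algC) : set algC := [set psl_act g z | g in [set: PSL2Z]]%classic.

Definition orbits (n : nat) : set (set algC) := [set orbit z | z in M n]%classic.

(* Division by zero is total in algC, so psl_act is an action only away from
   the reals; the next lemmas show that it restricts to an action on M n. *)
Lemma M_nonreal n z : (0 < n)%N -> M n z -> z \isn't Num.real.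
Proof.
move=> n0 [a [c [c0 _ ->]]]; apply/negP => zR.
have cC : (c%:~R : algC) != 0 by rewrite intr_eq0.
have sR : sqrtC (- n%:R : algC) \is Num.real.
  have -> : sqrtC (- n%:R : algC) = (a%:~R + sqrtC (- n%:R)) / c%:~R * c%:~R - a%:~R.
    by field.
  by apply: rpredB (realz _ _); apply: rpredM zR (realz _ _).
have := real_exprn_even_ge0 (n := 2) sR isT.
by rewrite sqrtCK oppr_ge0 lern0 -leqn0 leqNgt n0.
Qed.

Lemma moebius_den_neq0 (A : SL2Z) (z : algC) : z \isn't Num.real ->
  (val A 1 0)%:~R * z + (val A 1 1)%:~R != 0.
Proof.
move=> zR; apply/eqP => den0; have := det_SL2ZE A.
have [r0|r0] := eqVneq (val A 1 0) 0.
  move: den0; rewrite r0 mul0r add0r => /eqP; rewrite intr_eq0 => /eqP ->.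
  by rewrite !mulr0 subr0.
have rC : ((val A 1 0)%:~R : algC) != 0 by rewrite intr_eq0.
case/negP: zR; have -> : z = - (val A 1 1)%:~R / (val A 1 0)%:~R.
  by apply: (mulfI rC); rewrite mulrCA divff // mulr1; apply/eqP; rewrite -addr_eq0 den0.
by rewrite rpred_div ?rpredN ?realz.
Qed.

Lemma psl_act1 z : psl_act 1%g z = z.
Proof.
by rewrite psl_act_pi /moebius /= !mxE /= mul1r addr0 mul0r add0r divr1.
Qed.

Lemma psl_actM g h z : z \isn't Num.real ->
  psl_act (g * h)%g z = psl_act g (psl_act h z).
Proof.
elim/quotW: g => A; elim/quotW: h => B zR; rewrite [(_ * _)%g]PSL2Z_mul_pi !psl_act_pi.
have dB := moebius_den_neq0 B zR; have dAB := moebius_den_neq0 (A * B)%g zR.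
have l01 : lift ord0 ord0 = 1 :> 'I_2 by apply: val_inj.
move: dB dAB; rewrite /moebius /= !mxE !big_ord_recl !big_ord0 /= !l01 !addr0.
rewrite !(rmorphD, rmorphM) /=.
set a := (sval A 0 0)%:~R; set b := (sval A 0 1)%:~R.
set c := (sval A 1 0)%:~R; set e := (sval A 1 1)%:~R.
set a' := (sval B 0 0)%:~R; set b' := (sval B 0 1)%:~R.
set c' := (sval B 1 0)%:~R; set e' := (sval B 1 1)%:~R => dB dAB.
field; apply/andP; split=> //.
by apply: contraNneq dAB => <-; apply/eqP; ring.
Qed.

Lemma psl_act_M n g z : (0 < n)%N -> M n z -> M n (psl_act g z).
Proof.
elim/quotW: g => A n0 Mz; rewrite psl_act_pi.
have := moebius_den_neq0 A (M_nonreal n0 Mz); rewrite /moebius.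
case: Mz => a [c [c0 /dvdzP[b ab] ->]]; have := det_SL2ZE A.
move: (val A 0 0) (val A 0 1) (val A 1 0) (val A 1 1) => p q r t D den0.
have cC : (c%:~R : algC) != 0 by rewrite intr_eq0.
pose a' := p * r * b + (p * t + q * r) * a + q * t * c.
pose c' := r ^+ 2 * b + 2 * r * t * a + t ^+ 2 * c.
pose b' := p ^+ 2 * b + 2 * p * q * a + q ^+ 2 * c.
have nE : n%:Z = b * c - a ^+ 2 by rewrite -ab; ring.
have c'0 : c' != 0.
  apply: contraNneq den0 => c'0; apply/eqP.
  have : c' * c = (r * a + t * c) ^+ 2 + r ^+ 2 * n%:Z by rewrite nE /c'; ring.
  rewrite c'0 mul0r => /esym/eqP.
  have rn0 : 0 <= r ^+ 2 * n%:Z by rewrite mulr_ge0 ?sqr_ge0.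
  rewrite paddr_eq0 ?sqr_ge0 // sqrf_eq0 mulf_eq0 sqrf_eq0.
  have n0' : n%:Z == 0 = false by apply/negbTE; rewrite -lt0n.
  rewrite n0' orbF => /andP[+ /eqP r0]; rewrite r0 mul0r add0r mulf_eq0 (negbTE c0) orbF.
  by move=> /eqP ->; rewrite mul0r addr0.
exists a', c'; split=> //.
  apply/dvdzP; exists b'.
  have -> : n%:Z = (p * t - q * r) ^+ 2 * (b * c - a ^+ 2) by rewrite D -nE; ring.
  by rewrite /a' /b' /c'; ring.
have c'C : (c'%:~R : algC) != 0 by rewrite intr_eq0.
have := sqrtCK (- n%:R : algC); move: den0; set s := sqrtC _ => den0 sK.
have sE : s ^+ 2 = a%:~R ^+ 2 - b%:~R * c%:~R.
  by rewrite sK -[n%:R]/((n%:Z)%:~R) nE rmorphB rmorphXn rmorphM /= opprB.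
have DC : p%:~R * t%:~R - q%:~R * r%:~R = 1 :> algC.
  by rewrite -!rmorphM -rmorphB D.
have den1 : r%:~R * (a%:~R + s) + t%:~R * c%:~R != 0 :> algC.
  apply: contraNneq den0 => e; apply/eqP; apply: (mulIf cC).
  by rewrite mul0r -e; field.
apply/eqP; rewrite eqr_div //; apply/eqP; apply: (mulIf cC).
rewrite /a' /c' !(rmorphD, rmorphM, rmorphXn) /=.
move: (p%:~R : algC) (q%:~R : algC) (r%:~R : algC) (t%:~R : algC) DC => P Q R T DC.
apply: subr0_eq.
transitivity (- (R * (P * T - Q * R) * (s ^+ 2 - (a%:~R ^+ 2 - b%:~R * c%:~R)) +
    (1 - (P * T - Q * R)) * s * (R * (a%:~R + s) + T * c%:~R))); first by field.
by rewrite DC sE !subrr mulr0 !mul0r addr0 oppr0.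
Qed.

(* Main.v *)
Require Import Defs.
From mathcomp Require Import all_boot all_order all_algebra all_field.
From mathcomp Require Import classical_sets cardinality finmap.
From mathcomp Require Import zify ring.
Import Order.TTheory GRing.Theory Num.Theory.
Local Open Scope ring_scope.

Set Implicit Arguments.
Unset Strict Implicit.

(** The proof is reduction theory of binary quadratic forms, in the shape given
    to it by Selling: reduce to obtuse superbases rather than to a fundamental
    domain.

    A point of [M n] is (a + s) / c with s a square root of - n, and is encoded
    by the integers a, b, c with b c = a ^ 2 + n.  These are the coefficients of
    the definite form c x^2 - 2 a x y + b y^2, and Moebius transformations become
    the linear action of SL(2, Z) on such triples ([moebius_qpoint],
    [orbit_qpoint_eqP]).  The sign of c is constant on an orbit, so forms come in
    two copies, positive and negative.

    A positive form can be written
      a (x - y)^2 + (b - a) y^2 + (c - a) x^2,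
    and it is called normal here when a >= 0, b > a and c > a.  Every orbit
    contains a normal triple, by descent on b + c ([M_normal]).  For uniqueness
    consider S = b + c - a, half the sum of the values of the form on the three
    vectors of its superbase.  Applying a matrix to a normal triple multiplies
    the three coefficients in the sum of squares by positive integers before
    they are added to S; hence two equivalent normal triples have the same S,
    and then each column (p, r) and (q, t) of the matrix satisfies
    x^2 + y^2 - x y = 1, which leaves only finitely many matrices
    ([selling_sum_le], [obtuse_unique]).  Those that keep the triple normal fix
    it, permute the three coefficients cyclically or, when a = 0, exchange b
    and c.

    So an orbit contains three normal triples with a > 0, or two with a = 0;
    they are distinct since n is neither three times a square nor a square.
    Normal triples with a = 0 are the factorizations n = b c, and those with
    a = i > 0 are the factorizations of i^2 + n into two factors larger than i.
    As two factors cannot both be at most i, there are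
    d(i^2 + n) - 2 d_{<= i}(i^2 + n) of the latter, and none if i > n / 2.
    Taking both signs, the number of orbits is 2 d(n) / 2 plus 2/3 of the sum
    over i. *)

(** * Points of M n as integer triples *)

Local Notation orbit := Defs.orbit.

Definition qpoint (n : nat) (a c : int) : algC :=
  (a%:~R + sqrtC (- n%:R)) / c%:~R.

(** The integer b is determined by a and c, but keeping it makes the action of
    SL(2, Z) linear. *)
Definition on_shell (n : nat) (a b c : int) : Prop := b * c = a ^+ 2 + n%:Z.

Section Points.

Variables (n : nat) (n_gt0 : (0 < n)%N).

Lemma on_shell_neq0 a b c : on_shell n a b c -> c != 0.
Proof. by rewrite /on_shell => h; apply/eqP => c0; nia. Qed.

Lemma M_qpointP z :
  M n z <-> exists a b c, on_shell n a b c /\ z = qpoint n a c.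
Proof.
split=> [[a [c [_ /dvdzP[b h] ->]]]|[a [b [c [h ->]]]]].
  by exists a, b, c.
exists a, c; split=> //; first exact: on_shell_neq0 h.
by apply/dvdzP; exists b.
Qed.

Lemma M_qpoint a b c : on_shell n a b c -> M n (qpoint n a c).
Proof. by move=> h; apply/M_qpointP; exists a, b, c. Qed.

Lemma sqrt_nonreal : sqrtC (- n%:R : algC) \isn't Num.real.
Proof.
have /M_qpoint/(M_nonreal n_gt0) : on_shell n 0 n%:Z 1.
  by rewrite /on_shell; ring.
by rewrite /qpoint add0r divr1.
Qed.

(** 1 and the square root of - n are linearly independent over the rationals,
    because the square root is not real. *)
Lemma qpoint_inj a c a' c' : c != 0 -> c' != 0 ->
  qpoint n a c = qpoint n a' c' -> a = a' /\ c = c'.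
Proof.
move=> c0 c'0 /eqP; rewrite /qpoint; set s := sqrtC _.
rewrite eqr_div ?intr_eq0 // => /eqP h.
have e : (c'%:~R - c%:~R) * s = (a' * c - a * c')%:~R :> algC.
  rewrite rmorphB !rmorphM /=.
  by transitivity ((a%:~R + s) * c'%:~R - a%:~R * c'%:~R - c%:~R * s);
     [ring | rewrite h; ring].
have cc : c = c'.
  apply/eqP; apply: contraT => ne; case/negP: sqrt_nonreal.
  have d0 : (c' - c)%:~R != 0 :> algC by rewrite intr_eq0 subr_eq0 eq_sym.
  have -> : sqrtC (- n%:R) = (a' * c - a * c')%:~R / (c' - c)%:~R :> algC.
    by apply: (mulfI d0); rewrite mulrCA divff // mulr1 -e rmorphB.
  by rewrite rpred_div ?realz.
split=> //; subst c'.
have : (a' * c - a * c)%:~R = 0 :> algC by rewrite -e subrr mul0r.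
move/eqP; rewrite intr_eq0 -mulrBl mulf_eq0 (negbTE c0) orbF subr_eq0.
by move/eqP.
Qed.

(** The action of the matrix with rows (p, q) and (r, t) on triples: it is read
    off from the numerator and the norm of the denominator of the transformed
    point, after rationalizing the denominator. *)
Definition sends (p q r t a b c a' b' c' : int) : Prop :=
  [/\ p * t - q * r = 1,
      a' = p * r * b + (p * t + q * r) * a + q * t * c,
      b' = p ^+ 2 * b + 2 * p * q * a + q ^+ 2 * c
    & c' = r ^+ 2 * b + 2 * r * t * a + t ^+ 2 * c].

(** The discriminant b c - a^2 is multiplied by the square of the determinant. *)
Lemma sends_on_shell p q r t a b c a' b' c' :
  sends p q r t a b c a' b' c' -> on_shell n a b c -> on_shell n a' b' c'.
Proof.
case=> D -> -> ->; rewrite /on_shell => h.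
have -> : n%:Z = (p * t - q * r) ^+ 2 * (b * c - a ^+ 2) by rewrite D h; ring.
ring.
Qed.

(** The triples on both sides satisfy the shell equation, so neither c nor c'
    vanishes; after clearing denominators the claim is a polynomial identity
    modulo s^2 = a^2 - b c and the determinant equation. *)
Lemma moebius_qpoint (A : SL2Z) a b c a' b' c' :
  sends (val A 0 0) (val A 0 1) (val A 1 0) (val A 1 1) a b c a' b' c' ->
  on_shell n a b c -> moebius (val A) (qpoint n a c) = qpoint n a' c'.
Proof.
move=> S h; have h' := sends_on_shell S h.
have := moebius_den_neq0 A (M_nonreal n_gt0 (M_qpoint h)).
have c0 : (c%:~R : algC) != 0 by rewrite intr_eq0 (on_shell_neq0 h).
have c'0 : (c'%:~R : algC) != 0 by rewrite intr_eq0 (on_shell_neq0 h').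
have sE : sqrtC (- n%:R) ^+ 2 = a%:~R ^+ 2 - b%:~R * c%:~R :> algC.
  rewrite sqrtCK -rmorphXn -rmorphM -rmorphB h /=.
  by rewrite opprD addrA subrr add0r rmorphN.
move: S; rewrite /moebius /qpoint.
move: (val A 0 0) (val A 0 1) (val A 1 0) (val A 1 1) => p q r t [D aE _ cE] d0.
have DC : p%:~R * t%:~R - q%:~R * r%:~R = 1 :> algC.
  by rewrite -!rmorphM -rmorphB D.
apply/eqP; rewrite eqr_div //; apply/eqP; apply: (mulIf c0).
rewrite aE cE !(rmorphD, rmorphM, rmorphXn) /=.
move: (sqrtC _) sE => s sE.
move: (p%:~R : algC) (q%:~R : algC) (r%:~R : algC) (t%:~R : algC) DC => P Q R T DC.
(* The cofactors with which the difference lies in the ideal generated by the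
   two relations. *)
apply: subr0_eq.
transitivity (- (R * (P * T - Q * R) * (s ^+ 2 - (a%:~R ^+ 2 - b%:~R * c%:~R)) +
    (1 - (P * T - Q * R)) * s * (R * (a%:~R + s) + T * c%:~R))); first by field.
by rewrite DC sE !subrr mulr0 !mul0r addr0 oppr0.
Qed.

Lemma orbit_eqP z w : M n z -> orbit z = orbit w <-> exists g, w = psl_act g z.
Proof.
move=> Mz; have zR := M_nonreal n_gt0 Mz; split=> [e|[g ->]].
  have : orbit w w by exists 1%g => //; rewrite psl_act1.
  by rewrite -e => -[g _ <-]; exists g.
have gzR := M_nonreal n_gt0 (psl_act_M g n_gt0 Mz).
apply/seteqP; split=> _ [h _ <-].
  exists (h * g^-1)%g => //; rewrite psl_actM //.
  by rewrite -[psl_act g^-1%g _]psl_actM // mulVg psl_act1.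
by exists (h * g)%g => //; rewrite psl_actM.
Qed.

Lemma SL2Z_of_entries p q r t : p * t - q * r = 1 ->
  exists A : SL2Z, [/\ val A 0 0 = p, val A 0 1 = q, val A 1 0 = r & val A 1 1 = t].
Proof.
move=> D.
pose B : 'M[int]_2 := \matrix_(i, j)
  (if i == 0 then if j == 0 then p else q else if j == 0 then r else t).
suff dB : \det B == 1 by exists (exist _ B dB); rewrite /= !mxE.
have l0 (i : 'I_1) : lift (0 : 'I_2) i = 1 by apply: val_inj; case: i => [[]].
have l1 (i : 'I_1) : lift (1 : 'I_2) i = 0 by apply: val_inj; case: i => [[]].
rewrite (expand_det_row _ 0) !big_ord_recl big_ord0 /cofactor !det_mx11.
rewrite !mxE !l0 !l1 /= expr0 expr1 mul1r mulN1r mulrN addr0.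
by apply/eqP.
Qed.

Lemma orbit_qpoint_eqP a b c a' b' c' :
  on_shell n a b c -> on_shell n a' b' c' ->
  orbit (qpoint n a c) = orbit (qpoint n a' c') <->
  exists p q r t, sends p q r t a b c a' b' c'.
Proof.
move=> h h'; have c'0 := on_shell_neq0 h'.
apply: (iff_trans (orbit_eqP _ (M_qpoint h))); split.
  case=> g; elim/quotW: g => A; rewrite psl_act_pi.
  set p := val A 0 0; set q := val A 0 1; set r := val A 1 0; set t := val A 1 1.
  pose a1 := p * r * b + (p * t + q * r) * a + q * t * c.
  pose b1 := p ^+ 2 * b + 2 * p * q * a + q ^+ 2 * c.
  pose c1 := r ^+ 2 * b + 2 * r * t * a + t ^+ 2 * c.
  have S : sends p q r t a b c a1 b1 c1 by split=> //; apply: det_SL2ZE.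
  have h1 := sends_on_shell S h.
  rewrite (moebius_qpoint S h).
  case/(qpoint_inj c'0 (on_shell_neq0 h1)) => ea ec.
  exists p, q, r, t; rewrite ea ec.
  suff -> : b' = b1 by [].
  by apply: (mulIf c'0); rewrite h' ea ec h1.
case=> p [q [r [t S]]]; have [D _ _ _] := S.
have [A [Ep Eq Er Et]] := SL2Z_of_entries D.
exists (\pi_PSL2Z A)%qT; rewrite psl_act_pi.
by apply/esym/(@moebius_qpoint A a b c _ b') => //; rewrite Ep Eq Er Et.
Qed.

End Points.

(** * Obtuse triples and the Selling sum *)

Lemma sends_scale e p q r t a b c a' b' c' :
  sends p q r t a b c a' b' c' ->
  sends p q r t (e * a) (e * b) (e * c) (e * a') (e * b') (e * c').
Proof. by case=> D -> -> ->; split=> //; ring. Qed.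

Lemma sends_inv p q r t a b c a' b' c' :
  sends p q r t a b c a' b' c' -> sends t (- q) (- r) p a' b' c' a b c.
Proof.
case=> D -> -> ->; have D2 : (p * t - q * r) ^+ 2 = 1 by rewrite D.
split; first by rewrite -D; ring.
- transitivity ((p * t - q * r) ^+ 2 * a); [by rewrite D2 mul1r|ring].
- transitivity ((p * t - q * r) ^+ 2 * b); [by rewrite D2 mul1r|ring].
- transitivity ((p * t - q * r) ^+ 2 * c); [by rewrite D2 mul1r|ring].
Qed.

(** The Selling parameters a, b - a, c - a are nonnegative, the last two even
    positive: the basis vectors and minus their sum form an obtuse superbase.
    Excluding b = a and c = a selects, among the superbases of a form with a
    vanishing parameter, those for which the parameter a is the one that
    vanishes. *)
Definition obtuse (a b c : int) : Prop := [/\ 0 <= a, a < b & a < c].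

(** This is the norm form of the Eisenstein integers, positive definite because
    4 (x^2 + y^2 - x y) = (2 x - y)^2 + 3 y^2. *)
Lemma hex_norm_ge1 (x y : int) : (x != 0) || (y != 0) ->
  1 <= x ^+ 2 + y ^+ 2 - x * y.
Proof.
have sq_gt0 (u : int) : (0 < u ^+ 2) = (u != 0).
  by rewrite lt_neqAle sqr_ge0 andbT eq_sym sqrf_eq0.
move=> nz; rewrite -gtz0_ge1 -(pmulr_rgt0 _ (isT : 0 < 4 :> int)).
have -> : 4 * (x ^+ 2 + y ^+ 2 - x * y) = (2 * x - y) ^+ 2 + 3 * y ^+ 2 by ring.
have [y0|y0] := eqVneq y 0; last first.
  by rewrite ltr_wpDl ?sqr_ge0 // mulr_gt0 ?sq_gt0.
move: nz; rewrite y0 eqxx orbF => x0.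
have -> : (2 * x - 0) ^+ 2 + 3 * 0 ^+ 2 = (2 * x) ^+ 2 :> int by ring.
by rewrite sq_gt0 mulf_neq0.
Qed.

(** The new Selling sum is obtained from the old one by giving the three
    parameters a, b - a, c - a the weights X, Y, Z, the Eisenstein norms of the
    sum of the columns and of the columns themselves.  None of these vectors is
    zero when the determinant is 1, so the weights are at least 1; the strict
    inequalities b > a and c > a force Y = Z = 1 in case of equality. *)
Lemma selling_sum_le p q r t a b c a' b' c' :
  obtuse a b c -> sends p q r t a b c a' b' c' ->
  b + c - a <= b' + c' - a' /\
  (b + c - a = b' + c' - a' ->
    p ^+ 2 + r ^+ 2 - p * r = 1 /\ q ^+ 2 + t ^+ 2 - q * t = 1).
Proof.
case=> a0 ab ac [D -> -> ->].
set X := (p + q) ^+ 2 + (r + t) ^+ 2 - (p + q) * (r + t).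
set Y := p ^+ 2 + _ - _; set Z := q ^+ 2 + _ - _.
have X1 : 0 <= X - 1.
  rewrite subr_ge0; apply: hex_norm_ge1; apply/orP.
  case: eqP => [e|_]; [right|by left]; apply/eqP => e'.
  have : (p + q) * t - q * (r + t) = 1 by rewrite -D; ring.
  by rewrite e e' mul0r mulr0.
have Y1 : 0 <= Y - 1.
  rewrite subr_ge0; apply: hex_norm_ge1; apply/orP.
  case: eqP => [e|_]; [right|by left]; apply/eqP => e'.
  by move: D; rewrite e e' mul0r mulr0.
have Z1 : 0 <= Z - 1.
  rewrite subr_ge0; apply: hex_norm_ge1; apply/orP.
  case: eqP => [e|_]; [right|by left]; apply/eqP => e'.
  by move: D; rewrite e e' mul0r mulr0.
have -> : p ^+ 2 * b + 2 * p * q * a + q ^+ 2 * c +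
   (r ^+ 2 * b + 2 * r * t * a + t ^+ 2 * c) -
   (p * r * b + (p * t + q * r) * a + q * t * c)
  = b + c - a + (a * (X - 1) + (b - a) * (Y - 1) + (c - a) * (Z - 1)).
  by rewrite /X /Y /Z; ring.
have P1 : 0 <= a * (X - 1) by rewrite mulr_ge0.
have bpos : 0 < b - a by rewrite subr_gt0.
have cpos : 0 < c - a by rewrite subr_gt0.
have P2 : 0 <= (b - a) * (Y - 1) by rewrite mulr_ge0 // ltW.
have P3 : 0 <= (c - a) * (Z - 1) by rewrite mulr_ge0 // ltW.
split; first by rewrite lerDl !addr_ge0.
move=> e.
have /eqP : (b - a) * (Y - 1) = 0 by lia.
rewrite mulf_eq0 (gt_eqF bpos) subr_eq0 => /eqP.
have /eqP : (c - a) * (Z - 1) = 0 by lia.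
by rewrite mulf_eq0 (gt_eqF cpos) subr_eq0 => /eqP.
Qed.

(** Cyclic permutation of the Selling parameters, in the coordinates a, b, c. *)
Definition rotation_of (a b c a' b' c' : int) : Prop :=
  (a' = a /\ b' = b /\ c' = c) \/
  (a' = b - a /\ b' = b + c - 2 * a /\ c' = b) \/
  (a' = c - a /\ b' = c /\ c' = b + c - 2 * a).

(** The six units of the ring of Eisenstein integers. *)
Lemma hex_unit (x y : int) : x ^+ 2 + y ^+ 2 - x * y = 1 ->
  [\/ [\/ x = 1 /\ y = 0, x = 0 /\ y = 1 | x = 1 /\ y = 1] |
      [\/ x = -1 /\ y = 0, x = 0 /\ y = -1 | x = -1 /\ y = -1]].
Proof.
have bound (u v : int) : u ^+ 2 + v ^+ 2 - u * v = 1 -> -1 <= u <= 1.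
  move=> h.
  have : 4 * (u ^+ 2 + v ^+ 2 - u * v) = (2 * v - u) ^+ 2 + 3 * u ^+ 2 by ring.
  rewrite h.
  have := sqr_ge0 (2 * v - u); move: (_ ^+ 2) => w w0 e.
  by apply/andP; split; nia.
move=> h; have hx := bound _ _ h.
have hy : -1 <= y <= 1 by apply: (bound y x); rewrite -[RHS]h; ring.
have : x = -1 \/ x = 0 \/ x = 1 by case/andP: hx; lia.
have : y = -1 \/ y = 0 \/ y = 1 by case/andP: hy; lia.
case=> [|[]] ey [|[]] ex; move: h; rewrite ex ey => // _.
- by right; apply: Or33.
- by right; apply: Or32.
- by right; apply: Or31.
- by left; apply: Or31.
- by left; apply: Or32.
- by left; apply: Or33.
Qed.

(** The Selling sum can increase in neither direction, so it is constant, and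
    both columns of the matrix are Eisenstein units.  The determinant condition
    and the inequalities decide among the remaining matrices. *)
Lemma obtuse_unique p q r t a b c a' b' c' :
  obtuse a b c -> obtuse a' b' c' -> sends p q r t a b c a' b' c' ->
  rotation_of a b c a' b' c' \/ (a = 0 /\ a' = 0 /\ b' = c /\ c' = b).
Proof.
move=> ob ob' S.
have [le1 eq1] := selling_sum_le ob S.
have [le2 _] := selling_sum_le ob' (sends_inv S).
have /eq1[/hex_unit hY /hex_unit hZ] : b + c - a = b' + c' - a'.
  by apply/eqP; rewrite eq_le le1 le2.
case: ob ob' S => a0 ab ac [a0' ab' ac'] [D ea eb ec]; rewrite /rotation_of.
by case: hY => -[] [ep er]; case: hZ => -[] [eq et]; subst p q r t; lia.
Qed.

(** * Normal triples represent the orbits *)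

Definition normal (n : nat) (f : nat * nat * nat) : bool :=
  let: (a, b, c) := f in [&& b * c == a ^ 2 + n, a < b & a < c]%N.

Definition rot_form (f : nat * nat * nat) : nat * nat * nat :=
  let: (a, b, c) := f in (b - a, b + c - 2 * a, b)%N.

Definition swap_form (f : nat * nat * nat) : nat * nat * nat :=
  let: (a, b, c) := f in (a, c, b).

(** The normal triples equivalent to a given one. *)
Definition class_of (f : nat * nat * nat) : seq (nat * nat * nat) :=
  if f.1.1 == 0%N then [:: f; swap_form f]
  else [:: f; rot_form f; rot_form (rot_form f)].

(** The boolean is the sign of the form. *)
Definition point (n : nat) (x : bool * (nat * nat * nat)) : algC :=
  let: (e, (a, b, c)) := x in qpoint n ((-1) ^+ e * a%:Z) ((-1) ^+ e * c%:Z).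

Section Classes.

Variables (n : nat) (n_gt0 : (0 < n)%N).

Lemma on_shell_sign (e : bool) a b c : on_shell n a b c ->
  on_shell n ((-1) ^+ e * a) ((-1) ^+ e * b) ((-1) ^+ e * c).
Proof.
rewrite /on_shell => h.
by rewrite mulrACA -expr2 sqrr_sign mul1r h exprMn sqrr_sign mul1r.
Qed.

Lemma orbit_sends (e : bool) p q r t a b c a' b' c' :
  on_shell n a b c -> sends p q r t a b c a' b' c' ->
  orbit (qpoint n ((-1) ^+ e * a) ((-1) ^+ e * c)) =
  orbit (qpoint n ((-1) ^+ e * a') ((-1) ^+ e * c')).
Proof.
move=> h S; have h' := sends_on_shell S h.
have he := on_shell_sign e h; have he' := on_shell_sign e h'.
apply/(orbit_qpoint_eqP n_gt0 he he').
by exists p, q, r, t; apply: sends_scale.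
Qed.

(** Equivalent triples have the same sign, since c c' is (r a + t c)^2 + r^2 n. *)
Lemma sends_sign p q r t a b c a' b' c' : on_shell n a b c ->
  sends p q r t a b c a' b' c' -> 0 <= c * c'.
Proof.
move=> h [_ _ _ ->].
have -> : c * (r ^+ 2 * b + 2 * r * t * a + t ^+ 2 * c)
  = (r * a + t * c) ^+ 2 + r ^+ 2 * (b * c - a ^+ 2) by ring.
rewrite h [a ^+ 2 + _]addrC addrK addr_ge0 ?sqr_ge0 // mulr_ge0 ?sqr_ge0 //.
Qed.

Lemma normalP a b c : normal n (a, b, c) ->
  on_shell n a%:Z b%:Z c%:Z /\ obtuse a%:Z b%:Z c%:Z.
Proof.
case/and3P => /eqP h ab ac; split; last by split; rewrite ?ltz_nat.
by rewrite /on_shell expr2 -!PoszM h -mulnn.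
Qed.

Lemma orbit_class e f f' : normal n f -> f' \in class_of f ->
  orbit (point n (e, f)) = orbit (point n (e, f')).
Proof.
case: f => [[a b] c] /normalP[h [a0 ab ac]].
rewrite /class_of /=; case: eqP => [a00|_]; rewrite !inE.
  case/orP => /eqP -> //=; apply: (orbit_sends (p := 0) (q := -1) (r := 1) (t := 0)
    (b' := c%:Z) _ h).
  by split; lia.
case/or3P => /eqP -> //=.
  apply: (orbit_sends (p := 1) (q := -1) (r := 1) (t := 0)
    (b' := (b + c - 2 * a)%N%:Z) _ h).
  by split; lia.
apply: (orbit_sends (p := 0) (q := -1) (r := 1) (t := -1)
  (b' := c%:Z) _ h).
by split; lia.
Qed.

Lemma orbit_eq_class e e' f f' : normal n f -> normal n f' ->
  orbit (point n (e, f)) = orbit (point n (e', f')) ->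
  e' = e /\ f' \in class_of f.
Proof.
case: f f' => [[a b] c] [[a' b'] c'] nf nf'.
have [h ob] := normalP nf; have [h' ob'] := normalP nf'.
case/(orbit_qpoint_eqP n_gt0 (on_shell_sign e h) (on_shell_sign e' h')).
move=> p [q [r [t S]]].
have ee : e' = e.
  have := sends_sign (on_shell_sign e h) S; case: ob ob' => ? ? ? [? ? ?].
  case: (e) (e') => -[] //=;
    by rewrite !(expr0, expr1, mul1r, mulN1r, mulrN, mulNr) oppr_ge0; nia.
split=> //; subst e'; move: (sends_scale ((-1) ^+ e) S).
rewrite !mulrA -!expr2 !sqrr_sign !mul1r => /(obtuse_unique ob ob').
case: ob ob' => a0 ab ac [a0' ab' ac'].
rewrite /rotation_of /class_of /= => H.
by case: eqP => a00; rewrite !inE !xpair_eqE; lia.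
Qed.

(** Descent on b + c: if a >= c, translating by - 1 replaces a by a - c and b by
    b + c - 2 a < b; if a >= b, the transposed matrix does the same with b and c
    exchanged.  Both steps keep a nonnegative. *)
Lemma orbit_reduce N (e : bool) a b c : on_shell n a b c -> 0 <= a -> 0 < b -> 0 < c ->
  b + c <= N%:Z -> exists f, normal n f /\
  orbit (qpoint n ((-1) ^+ e * a) ((-1) ^+ e * c)) = orbit (point n (e, f)).
Proof.
elim: N a b c => [|N IH] a b c h a0 b0 c0 bN; first by lia.
have pos b1 c1 a1 : on_shell n a1 b1 c1 -> 0 < c1 -> 0 < b1.
  rewrite /on_shell => h1 c1_0; rewrite -(pmulr_lgt0 _ c1_0) h1.
  by rewrite ltr_wpDl ?sqr_ge0.
have [ca|ac] := leP c a.
  have S : sends 1 (-1) 0 1 a b c (a - c) (b + c - 2 * a) c by split; ring.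
  have h1 := sends_on_shell S h.
  rewrite (orbit_sends e h S); apply: (IH _ _ _ h1) => //; try lia.
  exact: pos h1 c0.
have [ba|ab] := leP b a.
  have S : sends 1 0 (-1) 1 a b c (a - b) b (b + c - 2 * a) by split; ring.
  have h1 := sends_on_shell S h.
  rewrite (orbit_sends e h S); apply: (IH _ _ _ h1) => //; try lia.
  by apply: (pos _ _ (a - b) _ b0); rewrite /on_shell -h1 mulrC.
exists (`|a|%N, `|b|%N, `|c|%N); split; last first.
  by rewrite /= !gez0_abs // (ltW c0).
apply/and3P; split; try lia.
by rewrite -eqz_nat PoszM PoszD -mulnn PoszM !gez0_abs ?(ltW b0) ?(ltW c0) // -expr2 h.
Qed.

(** Factoring out the sign of c makes b and c positive, and z -> - 1 / z makes a
    nonnegative; then [orbit_reduce] applies. *)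
Lemma M_normal z : M n z -> exists e f, normal n f /\ orbit z = orbit (point n (e, f)).
Proof.
case/M_qpointP => // a [b [c [h ->]]].
have [e [a1 [b1 [c1 [ea eb ec c10]]]]] : exists (e : bool) a1 b1 c1,
   [/\ a = (-1) ^+ e * a1, b = (-1) ^+ e * b1, c = (-1) ^+ e * c1 & 0 < c1].
  exists (c < 0), ((-1) ^+ (c < 0)%R * a), ((-1) ^+ (c < 0)%R * b),
    ((-1) ^+ (c < 0)%R * c).
  rewrite !mulrA -!expr2 !sqrr_sign !mul1r; split=> //.
  by rewrite -normrEsign normr_gt0 (on_shell_neq0 n_gt0 h).
have h1 : on_shell n a1 b1 c1.
  by have := on_shell_sign e h; rewrite ea eb ec !mulrA -!expr2 sqrr_sign !mul1r.
have b10 : 0 < b1.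
  by rewrite -(pmulr_lgt0 _ c10) h1 ltr_wpDl ?sqr_ge0.
exists e; rewrite ea ec; have [a10|a10] := leP 0 a1.
  by apply: (orbit_reduce (N := absz (b1 + c1)) e h1) => //; lia.
have S : sends 0 (-1) 1 0 a1 b1 c1 (- a1) c1 b1 by split; ring.
rewrite (orbit_sends e h1 S).
apply: (orbit_reduce (N := absz (b1 + c1)) e (sends_on_shell S h1)) => //; lia.
Qed.

Lemma point_M e f : normal n f -> M n (point n (e, f)).
Proof.
by case: f => [[a b] c] /normalP[h _]; apply: (M_qpoint n_gt0 (on_shell_sign e h)).
Qed.

(** (a + 1)^2 <= b c = a^2 + n. *)
Lemma normal_bound f : normal n f -> (f.1.1 <= n %/ 2)%N.
Proof.
case: f => [[a b] c] /and3P[/eqP e ab ac] /=.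
by have := leq_mul ab ac; rewrite e -mulnn; lia.
Qed.

Lemma class_normal f f' : normal n f -> f' \in class_of f ->
  normal n f' /\ (f'.1.1 == 0%N) = (f.1.1 == 0%N).
Proof.
case: f => [[a b] c] /and3P[/eqP e ab ac]; rewrite /class_of /normal -mulnn in e *.
case: eqP => /= a0; rewrite !inE.
  by case/orP => /eqP -> /=; split; try lia; apply/and3P; split; lia.
case/or3P => /eqP -> /=; (split; last by lia); rewrite -mulnn; apply/and3P; split; try lia.
Qed.

End Classes.

(** * Counting normal triples *)

(** Counting a list by the values of a function all of whose fibres have the same
    size. *)
Lemma size_undup_fibers (T U : eqType) (F : T -> U) (fib : T -> seq T) k
    (X : seq T) : uniq X ->
  (forall x, x \in X -> uniq (fib x) /\ size (fib x) = k) ->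
  (forall x y, x \in X -> (y \in fib x) = (y \in X) && (F y == F x)) ->
  size X = (k * size (undup (map F X)))%N.
Proof.
move=> uX fibP fibE; rewrite -(size_map F X).
rewrite -[in LHS](perm_size (perm_count_undup _)) size_flatten /shape -map_comp.
rewrite (@eq_in_map _ _ _ (fun=> k) _).1 => [|u].
  by elim: (undup _) => [|u s IH] /=; rewrite ?muln0 // IH mulnS.
rewrite mem_undup => /mapP[x xX ->] /=; rewrite size_nseq.
have [ux <-] := fibP _ xX.
rewrite count_map -size_filter; apply/perm_size/uniq_perm => //.
  exact: filter_uniq.
by move=> y; rewrite mem_filter fibE //= andbC.
Qed.

Lemma perm_codivisors m : (0 < m)%N ->
  perm_eq [seq (m %/ d)%N | d <- divisors m] (divisors m).
Proof.
move=> m0; have codivK d : d \in divisors m -> (m %/ (m %/ d))%N = d.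
  rewrite -dvdn_divisors // => /dvdnP[k em]; rewrite em in m0 *.
  have [k0 d0] : (0 < k)%N /\ (0 < d)%N by apply/andP; rewrite -muln_gt0.
  by rewrite mulnK // mulKn.
have codiv d : d \in divisors m -> (m %/ d)%N \in divisors m.
  by rewrite -!dvdn_divisors //; apply: dvdn_div.
apply: uniq_perm; rewrite ?divisors_uniq //.
  rewrite map_inj_in_uniq ?divisors_uniq // => d d' dm d'm e.
  by rewrite -(codivK d) // e codivK.
move=> d; apply/mapP/idP => [[d' /codiv dm ->] //|dm].
by exists (m %/ d)%N; rewrite ?codiv ?codivK.
Qed.

Definition forms_at (n i : nat) : seq (nat * nat * nat) :=
  let m := (i ^ 2 + n)%N in
  [seq (i, (m %/ c)%N, c) | c <- divisors m & (i < c)%N && (i < m %/ c)%N].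

(** The factorizations m = (m / c) c that are discarded have c <= i or
    m / c <= i.  Both cannot hold as i^2 < m, and the two cases are exchanged by
    c -> m / c. *)
Lemma size_forms_at n i : (0 < n)%N ->
  (size (forms_at n i) + 2 * ndiv_le i (i ^ 2 + n) = ndiv (i ^ 2 + n))%N.
Proof.
move=> n0; rewrite size_map size_filter /ndiv /ndiv_le.
set m := (i ^ 2 + n)%N; have m0 : (0 < m)%N by rewrite addn_gt0 n0 orbT.
set small := fun d => (d <= i)%N.
pose cosmall d := (m %/ d <= i)%N.
have coE : count cosmall (divisors m) = count small (divisors m).
  by rewrite -[RHS](permP (perm_codivisors m0)) count_map; apply: eq_count.
rewrite -(count_predC (predU small cosmall)) addnC mul2n -addnn; congr (_ + _)%N.
  rewrite -{2}coE -count_predUI.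
  rewrite -[RHS]addn0; congr (_ + _)%N; apply/eqP.
  rewrite -leqn0 leqNgt -has_count; apply/hasPn => d.
  rewrite -dvdn_divisors // => dm /=; apply/negP => /andP[h1 h2].
  have := leq_mul h2 h1; rewrite divnK // leqNgt mulnn /m.
  by rewrite -[X in (X < _)%N]addn0 ltn_add2l n0.
by apply: eq_count => d /=; rewrite negb_or -!ltnNge.
Qed.

Lemma mem_forms_at n i f : (0 < n)%N ->
  (f \in forms_at n i) = (f.1.1 == i) && normal n f.
Proof.
case: f => [[a b] c] n0 /=; set m := (i ^ 2 + n)%N.
have m0 : (0 < m)%N by rewrite addn_gt0 n0 orbT.
apply/mapP/idP => [[d]|/andP[/eqP -> /and3P[/eqP e ib ic]]].
  rewrite mem_filter -dvdn_divisors // => /andP[/andP[id idm] dm] [-> -> ->].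
  by rewrite eqxx divnK // eqxx id idm.
have c0 : (0 < c)%N by apply: leq_trans ic.
have em : (m %/ c)%N = b by rewrite /m -e mulnK.
exists c; rewrite ?em // mem_filter em ib ic -dvdn_divisors //=.
by rewrite /m -e dvdn_mull.
Qed.

Lemma uniq_forms_at n i : uniq (forms_at n i).
Proof.
by rewrite map_inj_uniq ?filter_uniq ?divisors_uniq // => c d [].
Qed.

Definition forms (n : nat) (s : seq nat) : seq (nat * nat * nat) :=
  flatten [seq forms_at n i | i <- s].

Lemma mem_forms n s f : (0 < n)%N ->
  (f \in forms n s) = (f.1.1 \in s) && normal n f.
Proof.
move=> n0; apply/flatten_mapP/andP => [[i si]|[fs fn]].
  by rewrite mem_forms_at // => /andP[/eqP -> ->].
by exists f.1.1; rewrite ?mem_forms_at ?eqxx.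
Qed.

Lemma uniq_forms n s : (0 < n)%N -> uniq s -> uniq (forms n s).
Proof.
move=> n0; elim: s => //= i s IH /andP[si us].
rewrite /forms /= cat_uniq uniq_forms_at IH // andbT.
apply/hasPn => f; rewrite -/(forms n s) mem_forms // => /andP[fs _].
by rewrite mem_forms_at //; apply: contra si => /andP[/eqP <-].
Qed.

Definition signed (s : seq (nat * nat * nat)) : seq (bool * (nat * nat * nat)) :=
  [seq (e, f) | e <- [:: true; false], f <- s].

Lemma mem_signed s x : (x \in signed s) = (x.2 \in s).
Proof.
apply/allpairsP/idP => [[[e f] /= [_ fs ->]] //|xs].
by exists x; split=> //; [case: (x.1)|case: (x)].
Qed.

Lemma uniq_signed s : uniq s -> uniq (signed s).
Proof. by move=> us; apply: allpairs_uniq => // -[? ?] [? ?]. Qed.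

Lemma size_signed s : size (signed s) = (2 * size s)%N.
Proof. by rewrite size_allpairs. Qed.

(** * Counting orbits *)

(** A coincidence forces b = c = 2 a, that is n = 3 a^2. *)
Lemma rot_form_neq n f : (3 < n)%N -> squarefree n -> normal n f ->
  f.1.1 != 0%N -> uniq [:: f; rot_form f; rot_form (rot_form f)].
Proof.
case: f => [[a b] c] n3 sqf /and3P[/eqP e ab ac] /= a0.
suff H : ~ (b = 2 * a /\ c = 2 * a)%N.
  by rewrite !inE !xpair_eqE; lia.
case=> eb ec; have en : n = (3 * a ^ 2)%N.
  by apply: (@addnI (a ^ 2)%N); rewrite -e eb ec -mulnn; ring.
have a1 : a = 1%N by apply: sqf; rewrite en dvdn_mull.
by move: n3; rewrite en a1.
Qed.

(** If b = c then n = b^2. *)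
Lemma swap_form_neq n f : (1 < n)%N -> squarefree n -> normal n f ->
  f.1.1 = 0%N -> uniq [:: f; swap_form f].
Proof.
case: f => [[a b] c] n1 sqf /and3P[/eqP e _ _] /= a0; subst a.
rewrite !inE !xpair_eqE /= andbT negb_and; apply/orP; left.
apply/eqP => bc; subst b; have en : n = (c ^ 2)%N by rewrite -mulnn e.
have c1 : c = 1%N by apply: sqf; rewrite en.
by move: n1; rewrite en c1.
Qed.

Section Counting.

Variables (n : nat) (n_gt3 : (3 < n)%N) (n_sqf : squarefree n).

Let n_gt0 : (0 < n)%N. Proof. by apply: leq_trans n_gt3. Qed.

Let orbs (s : seq nat) : seq (set algC) :=
  [seq orbit (point n x) | x <- signed (forms n s)].

(** The boolean z says which of the two families, a = 0 or a > 0, the list s of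
    values of a selects; each is a union of classes, so it contains a fibre of
    the orbit map as soon as it meets it. *)
Lemma size_orbs (z : bool) s : uniq s ->
  (forall f, normal n f -> (f.1.1 \in s) = ((f.1.1 == 0%N) == z)) ->
  (2 * \sum_(i <- s) size (forms_at n i) =
   (if z then 2 else 3) * size (undup (orbs s)))%N.
Proof.
move=> us sE; have n_gt1 : (1 < n)%N by apply: leq_trans n_gt3.
have -> : (\sum_(i <- s) size (forms_at n i) = size (forms n s))%N.
  by rewrite size_flatten /shape -map_comp sumnE big_map.
rewrite -size_signed.
apply: (size_undup_fibers (fib := fun x => [seq (x.1, f) | f <- class_of x.2])).
- exact/uniq_signed/uniq_forms.
- move=> [e f]; rewrite mem_signed mem_forms // => /andP[+ nf] /=.
  rewrite sE // size_map map_inj_uniq => [|? ? []//] /eqP <-.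
  rewrite /class_of; case: eqP => f0; split=> //.
    exact: (@swap_form_neq n).
  by apply: (@rot_form_neq n) => //; apply/eqP.
move=> [e f] [e' f']; rewrite !mem_signed !mem_forms //= => /andP[fs nf].
apply/mapP/andP => [[f1 f1c [-> ->]]|[/andP[f's nf'] /eqP eo]].
  have [nf1 e0] := class_normal n_gt0 nf f1c.
  by rewrite nf1 andbT (orbit_class n_gt0 _ nf f1c) eqxx sE // e0 -sE.
have [-> f'c] := orbit_eq_class n_gt0 nf nf' (esym eo).
by exists f'.
Qed.

Let tall := iota 1 (n %/ 2).

Lemma orbits_normal : orbits n =
  [set` [fset y in orbs [:: 0%N] ++ orbs tall]%fset]%classic.
Proof.
apply/seteqP; split=> [_ [z Mz <-]|o] /=.
  have [e [f [nf ->]]] := M_normal n_gt0 Mz.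
  rewrite in_fset /= mem_cat.
  have [f0|f0] := eqVneq f.1.1 0%N; apply/orP; [left|right];
    apply/mapP; exists (e, f) => //;
    rewrite mem_signed mem_forms //= nf andbT ?inE ?f0 //.
  by rewrite mem_iota lt0n f0 add1n ltnS (normal_bound n_gt0).
rewrite in_fset /= mem_cat => /orP[] /mapP[[e f]];
  rewrite mem_signed mem_forms //;
  by move=> /andP[_ nf] ->; exists (point n (e, f)) => //; apply: point_M.
Qed.

Lemma orbs_disjoint o : o \in orbs [:: 0%N] -> o \notin orbs tall.
Proof.
case/mapP => -[e f]; rewrite mem_signed mem_forms // inE => /andP[/= /eqP f0 nf] ->.
apply/mapP => -[[e' f']]; rewrite mem_signed mem_forms // => /andP[/= f't nf'].
move=> /(orbit_eq_class n_gt0 nf nf')[_ /(class_normal n_gt0 nf)[_ /esym]].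
by rewrite f0 eqxx => /esym/eqP f'0; move: f't; rewrite f'0 mem_iota.
Qed.

Lemma card_orbits_normal :
  finite_set (orbits n) /\
  (3 * #|` fset_set (orbits n)|%fset =
   3 * ndiv n + 2 * \sum_(1 <= i < (n %/ 2).+1) size (forms_at n i))%N.
Proof.
rewrite orbits_normal; split; first exact: finite_fset.
rewrite set_fsetK card_fseq undup_cat size_cat.
rewrite (_ : [seq _ <- _ | _] = undup (orbs [:: 0%N])); last first.
  by apply/all_filterP/allP => o; rewrite mem_undup; apply: orbs_disjoint.
rewrite mulnDr; congr (_ + _)%N; last first.
  rewrite -(@size_orbs false) ?iota_uniq // => [|f nf].
    by rewrite /index_iota subn1.
  by rewrite mem_iota lt0n add1n ltnS (normal_bound n_gt0 nf) andbT; case: eqP.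
congr (_ * _)%N; apply/eqP; rewrite -(@eqn_pmul2l 2) // eq_sym; apply/eqP.
rewrite -(@size_orbs true) // => [|f nf]; last by rewrite inE eqb_id.
rewrite big_seq1; congr (_ * _)%N.
have small0 : ndiv_le 0 (0 ^ 2 + n) = 0%N.
  apply/eqP; rewrite eqn0Ngt -has_count; apply/hasPn => d.
  by rewrite -dvdn_divisors // leqn0 -lt0n; apply: dvdn_gt0.
by have := size_forms_at 0 n_gt0; rewrite small0 addn0.
Qed.

End Counting.

Unset Implicit Arguments.

Theorem theorem2p3 (n : nat) (n_gt3 : (3 < n)%N) (n_sqf : squarefree n) :
  finite_set (orbits n) /\
  (#|` fset_set (orbits n)|%fset%:R : rat) =
    (ndiv n)%:R
    + 2 / 3 * \sum_(1 <= i < (n %/ 2).+1)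
        ((ndiv (i ^ 2 + n)%N)%:R - 2 * (ndiv_le i (i ^ 2 + n)%N)%:R).
Proof.
have n_gt0 : (0 < n)%N by apply: leq_trans n_gt3.
have [fin card3] := card_orbits_normal n_gt3 n_sqf; split=> //.
have -> : \sum_(1 <= i < (n %/ 2).+1)
    ((ndiv (i ^ 2 + n)%N)%:R - 2 * (ndiv_le i (i ^ 2 + n)%N)%:R)
  = (\sum_(1 <= i < (n %/ 2).+1) size (forms_at n i))%N%:R :> rat.
  rewrite natr_sum; apply: eq_bigr => i _.
  by rewrite -(size_forms_at i n_gt0) natrD natrM addrK.
move/(congr1 (fun k => k%:R : rat)): card3; rewrite natrD !natrM => card3.
have nz3 : (3 : rat) != 0 by [].
by apply: (mulfI nz3); rewrite card3; field.
Qed.
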